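(* If $X=[x_{ij}],Y=[y_{ij}]\in\mathbb{M}_n$ are accretive-dissipative, then $$\omega(X\circ Y)\le2\min\left\{\max_j|x_{jj}|\;\omega(Y),\ \max_j|y_{jj}|\;\omega(X)\right\}.$$
   Context: $\mathbb{M}_n$ is the algebra of all $n\times n$ complex matrices. For $X=[x_{ij}],Y=[y_{ij}]\in\mathbb{M}_n$ the Hadamard product is $X\circ Y=[x_{ij}y_{ij}]$. For $X\in\mathbb{M}_n$, write $\operatorname{Re}X=\frac{X+X^*}{2}$ and $\operatorname{Im}X=\frac{X-X^*}{2i}$ (both Hermitian). $X$ is accretive-dissipative if both $\operatorname{Re}X$ and $\operatorname{Im}X$ are positive definite. The numerical radius is $\omega(X)=\sup\{|\langle Xx,x\rangle| : x\in\mathbb{C}^n,\ \|x\|=1\}$, with the standard inner product and Euclidean norm on $\mathbb{C}^n$. *)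

(* Defs.v *)
From mathcomp Require Import all_boot all_order all_algebra.
From mathcomp Require Import complex.
From mathcomp Require Import classical_sets reals.

Set Implicit Arguments.
Unset Strict Implicit.
Unset Printing Implicit Defensive.

Import Order.TTheory GRing.Theory Num.Theory.
Local Open Scope ring_scope.
Local Open Scope classical_set_scope.
Local Open Scope sesquilinear_scope.
Local Open Scope complex_scope.

Definition hadamard (R : realType) (n : nat) (X Y : 'M[R[i]]_n) : 'M[R[i]]_n :=
  map2_mx *%R X Y.

Definition Remx (R : realType) (n : nat) (X : 'M[R[i]]_n) : 'M[R[i]]_n :=
  2^-1 *: (X + X^t*).

Definition Immx (R : realType) (n : nat) (X : 'M[R[i]]_n) : 'M[R[i]]_n :=
  (2 * 'i%C)^-1 *: (X - X^t*).

(* <u, v> = v^* u, conjugate-linear in the second argument. *)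
Definition cdot (R : realType) (n : nat) (u v : 'cV[R[i]]_n) : R[i] :=
  (v^t* *m u) 0 0.

(* [Normc.normc z] is the modulus |z| as an element of R; the generic [`|z|]
   takes its values in R[i], which has no supremum operator. *)
Definition cnorm (R : realType) (n : nat) (x : 'cV[R[i]]_n) : R :=
  Num.sqrt (\sum_(i < n) Normc.normc (x i 0) ^+ 2).

(* In R[i], [0 < z] means that z is real and positive. *)
Definition posdefmx (R : realType) (n : nat) (A : 'M[R[i]]_n) : Prop :=
  A \is hermsymmx /\ (forall x : 'cV[R[i]]_n, x != 0 -> 0 < cdot (A *m x) x).

Definition accretive_dissipative (R : realType) (n : nat) (X : 'M[R[i]]_n) :
    Prop :=
  posdefmx (Remx X) /\ posdefmx (Immx X).

Definition numerical_radius (R : realType) (n : nat) (X : 'M[R[i]]_n) : R :=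
  sup [set Normc.normc (cdot (X *m x) x) |
        x in [set x : 'cV[R[i]]_n | cnorm x = 1]].

(* max_j |x_jj|; the default value 0 is harmless, since moduli are >= 0. *)
Definition max_diag (R : realType) (n : nat) (X : 'M[R[i]]_n) : R :=
  \big[Num.max/0]_(j < n) Normc.normc (X j j).

(* Main.v *)
(** Write [X = A + iB] with [A], [B] positive definite.  By the spectral theorem
    [a_ij = \sum_k d_k conj(p_ki) p_kj] with [d_k >= 0], hence
    [<(A o Y) x, x> = \sum_k d_k <Y z_k, z_k>] where [(z_k)_j = p_kj x_j].
    Bounding each form by [w(Y) ||z_k||^2] and summing over [k] first gives
    [|<(A o Y) x, x>| <= w(Y) \sum_j a_jj |x_j|^2].  The same holds for [B], and
    [a_jj, b_jj <= |x_jj|], whence the factor 2; the other half of the minimum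
    is the commutativity of the Hadamard product. *)

Require Import Defs.
From mathcomp Require Import all_boot all_order all_algebra.
From mathcomp Require Import complex.
From mathcomp Require Import classical_sets reals.
From mathcomp Require Import ring.

Local Open Scope ring_scope.
Local Open Scope complex_scope.

Import Order.TTheory GRing.Theory Num.Theory.

Set Implicit Arguments.
Unset Strict Implicit.
Unset Printing Implicit Defensive.

Section NumericalRadius.

Local Open Scope sesquilinear_scope.

Variables (R : realType) (n : nat).
Implicit Types (A X Y : 'M[R[i]]_n) (x z : 'cV[R[i]]_n).

Lemma normr_normc (a : R[i]) : `|a| = (Normc.normc a)%:C.
Proof. by []. Qed.

Lemma normc_ge0 (a : R[i]) : 0 <= Normc.normc a.
Proof. by rewrite -lecR -normr_normc normr_ge0. Qed.

Lemma cdot_mulmxE A x :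
  cdot (A *m x) x = \sum_i \sum_j (x i 0)^*%R * (A i j * x j 0).
Proof.
rewrite /cdot mxE; apply: eq_bigr => i _.
by rewrite !mxE mulr_sumr.
Qed.

Lemma cdot_mulmxZ A (c : R[i]) x :
  cdot (A *m (c *: x)) (c *: x) = `|c| ^+ 2 * cdot (A *m x) x.
Proof.
rewrite !cdot_mulmxE mulr_sumr; apply: eq_bigr => i _.
rewrite mulr_sumr; apply: eq_bigr => j _.
by rewrite !mxE rmorphM normCK; ring.
Qed.

Lemma cnorm_ge0 x : 0 <= cnorm x.
Proof. exact: sqrtr_ge0. Qed.

Lemma sqr_cnorm x : cnorm x ^+ 2 = \sum_i Normc.normc (x i 0) ^+ 2.
Proof. by rewrite sqr_sqrtr // sumr_ge0 // => i _; rewrite sqr_ge0. Qed.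

Lemma sqr_cnormC x : ((cnorm x)%:C) ^+ 2 = \sum_i `|x i 0| ^+ 2.
Proof.
by rewrite -rmorphXn sqr_cnorm rmorph_sum; apply: eq_bigr => i _; rewrite rmorphXn.
Qed.

Lemma cnorm_eq0 x : cnorm x = 0 -> x = 0.
Proof.
move=> x0; have := sqr_cnormC x; rewrite x0 expr0n => /esym/eqP.
rewrite psumr_eq0 => [/allP x0i|i _]; last exact: exprn_ge0.
apply/colP => i; rewrite mxE; apply/eqP.
by have := x0i i (mem_index_enum _); rewrite sqrf_eq0 normr_eq0.
Qed.

Lemma cnormZ (c : R[i]) x : cnorm (c *: x) = Normc.normc c * cnorm x.
Proof.
apply/eqP; rewrite -(@eqrXn2 _ 2) ?cnorm_ge0 ?mulr_ge0 ?normc_ge0 ?cnorm_ge0 //.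
rewrite exprMn !sqr_cnorm mulr_sumr; apply/eqP; apply: eq_bigr => i _.
by rewrite mxE Normc.normcM exprMn.
Qed.

Lemma normr_le_cnorm x i : `|x i 0| <= (cnorm x)%:C.
Proof.
rewrite -(@ler_pXn2r _ 2) ?nnegrE ?ler0c ?cnorm_ge0 ?normc_ge0 //.
rewrite sqr_cnormC (bigD1 i) //= lerDl sumr_ge0 // => j _.
exact: exprn_ge0.
Qed.

(** Guarantees that the [sup] in [numerical_radius] really dominates each value of the form. On the
    unit sphere every coordinate has modulus at most 1, so the triangle inequality bounds the form
    by the sum of the moduli of the entries. *)
Lemma numerical_radius_has_ubound Y :
  has_ubound [set Normc.normc (cdot (Y *m x) x) |
    x in [set x : 'cV[R[i]]_n | cnorm x = 1]]%classic.
Proof.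
exists (\sum_i \sum_j Normc.normc (Y i j)) => _ [x /= x1 <-].
have xi_le1 i : `|x i 0| <= 1 by have := normr_le_cnorm x i; rewrite x1.
rewrite -lecR -normr_normc cdot_mulmxE rmorph_sum.
apply: le_trans (ler_norm_sum _ _ _) _; apply: ler_sum => i _.
rewrite rmorph_sum; apply: le_trans (ler_norm_sum _ _ _) _; apply: ler_sum => j _.
rewrite !normrM norm_conjC mulrCA.
by rewrite ler_piMr // mulr_ile1.
Qed.

(** Homogeneity: for nonzero [x], write [x] as [cnorm x] times a unit vector [u]; the factor
    [cnorm x ^+ 2] comes out of the form and the value at [u] lies below the supremum. *)
Lemma norm_cdot_le Y x :
  `|cdot (Y *m x) x| <= (numerical_radius Y)%:C * \sum_i `|x i 0| ^+ 2.
Proof.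
have [x0|xN0] := eqVneq (cnorm x) 0.
  rewrite (cnorm_eq0 x0) /cdot mulmx0 mulmx0 mxE normr0 big1 ?mulr0 // => i _.
  by rewrite mxE normr0 expr0n.
have cN0 : (cnorm x)%:C != 0 by apply: contra_neq xN0 => /complexI.
have c_ge0 : 0 <= (cnorm x)%:C by rewrite ler0c cnorm_ge0.
pose u := (cnorm x)%:C^-1 *: x.
have u1 : cnorm u = 1.
  have nE : Normc.normc (cnorm x)%:C = cnorm x.
    by apply: complexI; rewrite -normr_normc ger0_norm.
  by rewrite cnormZ Normc.normcV nE mulVf.
rewrite -sqr_cnormC -[x in cdot _ x](scalerKV cN0) -/u.
rewrite -[x in _ *m x](scalerKV cN0) -/u cdot_mulmxZ normrM normrX normr_id.
rewrite (ger0_norm c_ge0) mulrC ler_wpM2r ?exprn_ge0 //.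
rewrite normr_normc lecR; apply: ub_le_sup; first exact: numerical_radius_has_ubound.
by exists u.
Qed.

Lemma posdefmx_gram A : posdefmx A ->
  exists (P : 'M[R[i]]_n) (d : 'I_n -> R[i]), (forall k, 0 <= d k) /\
    forall i j, A i j = \sum_k d k * ((P k i)^*%R * P k j).
Proof.
move=> [hermA posA]; pose P := spectralmx A; pose D := spectral_diag A.
have unitP : P \is unitarymx := spectral_unitarymx A.
have AE : A = P^t* *m diag_mx D *m P.
  by rewrite -invmx_unitary //; apply/orthomx_spectralP/hermitian_normalmx.
exists P, (D 0); split=> [k|i j]; last first.
  rewrite {1}AE mxE; apply: eq_bigr => k _.
  by rewrite mul_mx_diag !mxE mulrA [D 0 k * _]mulrC.
(* [v] is the [k]-th column of [P^t*], an eigenvector of [A] for [D 0 k]; positivity of the form at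
   [v] gives the sign of this eigenvalue. *)
pose v := P^t* *m (delta_mx k 0 : 'cV_n).
have -> : D 0 k = cdot (A *m v) v.
  rewrite /cdot {1}AE /v trmx_mul map_mxM trmxCK -!mulmxA.
  rewrite [P *m (P^t* *m _)]mulmxA (unitarymxP unitP) mul1mx.
  rewrite [P *m (P^t* *m _)]mulmxA (unitarymxP unitP) mul1mx.
  rewrite trmx_delta map_delta_mx -rowE mxE mul_diag_mx !mxE !eqxx mulr1 //.
have [->|/posA/ltW//] := eqVneq v 0.
by rewrite /cdot !mulmx0 mxE.
Qed.

Lemma posdefmx_diag_ge0 A j : posdefmx A -> 0 <= A j j.
Proof.
move=> /posdefmx_gram[P [d [d_ge0 ->]]]; apply: sumr_ge0 => k _.
by rewrite mulr_ge0 // -normCKC exprn_ge0.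
Qed.

Lemma cdot_hadamard_posdef_le A Y x : posdefmx A ->
  `|cdot (hadamard A Y *m x) x| <=
    (numerical_radius Y)%:C * \sum_j A j j * `|x j 0| ^+ 2.
Proof.
move=> /posdefmx_gram[P [d [d_ge0 AE]]].
pose z k : 'cV[R[i]]_n := \col_j (P k j * x j 0).
(* Both sides are triple sums; once the sum over [k] is innermost, [AE] matches them term by
   term. *)
have -> : cdot (hadamard A Y *m x) x = \sum_k d k * cdot (Y *m z k) (z k).
  under [RHS]eq_bigr => k _ do rewrite cdot_mulmxE mulr_sumr.
  rewrite exchange_big cdot_mulmxE /=; apply: eq_bigr => i _.
  under [RHS]eq_bigr => k _ do rewrite mulr_sumr.
  rewrite exchange_big /=; apply: eq_bigr => j _.
  rewrite !mxE AE !mulr_suml mulr_sumr; apply: eq_bigr => k _.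
  by rewrite !mxE rmorphM; ring.
apply: le_trans (ler_norm_sum _ _ _) _.
(* The weights recombine into the diagonal of [A], since [AE] at [i = j] reads
   [A j j = \sum_k d k * |P k j| ^+ 2]. *)
have -> : \sum_j A j j * `|x j 0| ^+ 2 = \sum_k d k * \sum_i `|z k i 0| ^+ 2.
  under [RHS]eq_bigr => k _ do rewrite mulr_sumr.
  rewrite exchange_big /=; apply: eq_bigr => j _.
  rewrite AE mulr_suml; apply: eq_bigr => k _.
  by rewrite mxE normrM exprMn [`|P k j| ^+ 2]normCKC -[LHS]mulrA.
rewrite mulr_sumr; apply: ler_sum => k _.
by rewrite normrM ger0_norm // mulrCA ler_wpM2l // norm_cdot_le.
Qed.

Lemma Remx_Immx X : X = Remx X + 'i%C *: Immx X.
Proof.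
have iN0 : 'i%C != 0 :> R[i] by rewrite eq_complex /= oner_eq0 andbF.
by apply/matrixP => i j; rewrite !mxE; field.
Qed.

Lemma cdot_hadamard_split X Y x :
  cdot (hadamard X Y *m x) x =
    cdot (hadamard (Remx X) Y *m x) x + 'i%C * cdot (hadamard (Immx X) Y *m x) x.
Proof.
have -> : hadamard X Y = hadamard (Remx X) Y + 'i%C *: hadamard (Immx X) Y.
  apply/matrixP => i j; rewrite {1}(Remx_Immx X).
  by rewrite [LHS]mxE [X in X * _]mxE [X in _ + X]mxE !mxE mulrDl mulrA.
by rewrite /cdot mulmxDl mulmxDr -scalemxAl -scalemxAr [LHS]mxE [X in _ + X]mxE.
Qed.

Lemma normr_i : `|'i%C : R[i]| = 1.
Proof. by rewrite normc_def /= expr0n expr1n add0r sqrtr1. Qed.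

Lemma norm_Remx_diag_le X j : `|Remx X j j| <= `|X j j|.
Proof.
rewrite !mxE normrM ger0_norm ?invr_ge0 // ler_pdivrMl ?ltr0n //.
by rewrite (le_trans (ler_normD _ _)) // norm_conjC mulr_natl mulr2n.
Qed.

Lemma norm_Immx_diag_le X j : `|Immx X j j| <= `|X j j|.
Proof.
rewrite !mxE normrM normfV normrM normr_i mulr1 ger0_norm // ler_pdivrMl ?ltr0n //.
by rewrite (le_trans (ler_normB _ _)) // norm_conjC mulr_natl mulr2n.
Qed.

Lemma numerical_radius_hadamard_le X Y : (0 < n)%N -> accretive_dissipative X ->
  numerical_radius (hadamard X Y) <= 2 * (max_diag X * numerical_radius Y).
Proof.
move=> n_gt0 [posA posB]; apply: ge_sup => [|_ [x /= x1 <-]].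
  (* Bounding a [sup] from above requires a nonempty set; the first basis vector, which exists as
     [0 < n], is a unit vector. *)
  exists (Normc.normc (cdot (hadamard X Y *m delta_mx (Ordinal n_gt0) 0)
                            (delta_mx (Ordinal n_gt0) 0))).
  exists (delta_mx (Ordinal n_gt0) 0) => //=.
  rewrite /cnorm (bigD1 (Ordinal n_gt0)) //= big1 => [|i iN0].
    by rewrite mxE !eqxx Normc.normc1 expr1n addr0 sqrtr1.
  by rewrite mxE (negPf iN0) Normc.normc0 expr0n.
have sum1 : \sum_j `|x j 0| ^+ 2 = 1 by rewrite -sqr_cnormC x1 expr1n.
have w_ge0 : 0 <= (numerical_radius Y)%:C.
  by have := norm_cdot_le Y x; rewrite sum1 mulr1; apply: le_trans.
(* The sum is a convex combination of the diagonal entries of [C], with weights [|x j 0| ^+ 2] of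
   total 1. It is applied to [Remx X] and to [Immx X]. *)
have diag_le C : posdefmx C -> (forall j, `|C j j| <= `|X j j|) ->
    \sum_j C j j * `|x j 0| ^+ 2 <= (max_diag X)%:C.
  move=> posC CX; rewrite -[leRHS]mulr1 -sum1 mulr_sumr.
  apply: ler_sum => j _; rewrite ler_wpM2r ?exprn_ge0 //.
  rewrite -(ger0_norm (posdefmx_diag_ge0 j posC)) (le_trans (CX j)) //.
  by rewrite normr_normc lecR /max_diag le_bigmax.
rewrite -lecR -normr_normc cdot_hadamard_split.
apply: le_trans (ler_normD _ _) _; rewrite normrM normr_i mul1r.
rewrite [_ * numerical_radius Y]mulrC rmorphM rmorphM rmorph_nat mulr_natl mulr2n.
apply: lerD; apply: le_trans (cdot_hadamard_posdef_le _ _ _) _ => //.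
  by rewrite ler_wpM2l // diag_le // => j; exact: norm_Remx_diag_le.
by rewrite ler_wpM2l // diag_le // => j; exact: norm_Immx_diag_le.
Qed.

End NumericalRadius.

Theorem corollary2p7 (R : realType) (n : nat) (n_gt0 : (0 < n)%N)
    (X Y : 'M[R[i]]_n)
    (adX : accretive_dissipative X) (adY : accretive_dissipative Y) :
  numerical_radius (hadamard X Y)
    <= 2 * Num.min (max_diag X * numerical_radius Y)
                   (max_diag Y * numerical_radius X).
Proof.
have hadamardC : hadamard X Y = hadamard Y X.
  by apply/matrixP => i j; rewrite !mxE mulrC.
(* The minimum is one of its two arguments, so each case asks for a single bound. *)
rewrite minEle; case: ifP => _; first exact: numerical_radius_hadamard_le.
by rewrite hadamardC; exact: numerical_radius_hadamard_le.
Qed.
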